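(* Let $G$ be a compact connected Lie group with a Haar measure $\mu$, and let $K\subset G$ be a countable (possibly non-closed) normal subgroup, regarded as a discrete group. Let $\overset{\circ}{*}$ and $\overset{\bullet}{*}$ be the two convolution products on $C_c^\infty(K\times G)$ associated with the action groupoid structure and with the product group structure, respectively. Let $\pi$ be an $n$-dimensional (complex) representation of $G$ with matrix coefficients $\pi_{ij}$, $1\le i,j\le n$. Then for all $u,v\in C^\infty(G)$, all $\kappa_1,\kappa_2,\lambda_1,\lambda_2\in K$ and all $1\le i,k\le n$, $$\sum_{j=1}^{n}\big(u^{\kappa_1}\overset{\circ}{*}\pi_{ij}^{\lambda_1}\big)\overset{\bullet}{*}\big(v^{\kappa_2}\overset{\circ}{*}\pi_{jk}^{\lambda_2}\big)=\sum_{j=1}^{n}\big(u^{\kappa_1}\overset{\bullet}{*}v^{\kappa_2}\big)\overset{\circ}{*}\big(\pi_{ij}^{\lambda_1}\overset{\bullet}{*}\pi_{jk}^{\lambda_2}\big).$$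
   Context: $G$ carries a Haar measure $\mu$; $K$ carries the discrete topology and counting measure. (Being countable and normal in a connected group, $K$ lies in the center of $G$.) $C^\infty(G)$ denotes the complex-valued smooth functions on $G$, and $C_c^\infty(K\times G)$ the complex-valued, compactly supported smooth functions on $K\times G$. On $K\times G$ there are two groupoid products: the action groupoid $K\ltimes G\rightrightarrows G$ with source $s(\kappa,g)=g$, target $t(\kappa,g)=\kappa g$ and composition $(\kappa_1,\kappa_2g)\circ(\kappa_2,g)=(\kappa_1\kappa_2,g)$; and the product group structure $(\kappa_1,g_1)\bullet(\kappa_2,g_2)=(\kappa_1\kappa_2,g_1g_2)$. The associated convolutions are, for $f,f'\in C_c^\infty(K\times G)$, $$(f\overset{\circ}{*}f')(x,y)=\sum_{\ell\in K}f(\ell,\ell^{-1}xy)\,f'(\ell^{-1}x,y),\qquad (f\overset{\bullet}{*}f')(x,y)=\sum_{\ell\in K}\int_G f(\ell,h)\,f'(\ell^{-1}x,h^{-1}y)\,\mathrm{d}\mu(h).$$ For $u\in C^\infty(G)$ and $\kappa\in K$, $u^\kappa\in C_c^\infty(K\times G)$ is the function with $u^\kappa(x,y)=u(y)$ if $x=\kappa$ and $u^\kappa(x,y)=0$ otherwise. A representation is a continuous homomorphism $\pi:G\to \mathrm{GL}(V_\pi)$ with $V_\pi$ a finite-dimensional complex vector space. It is understood that $V_\pi$ has a Hilbert space structure for which $\pi$ is unitary, with a chosen ordered orthonormal basis $e_1,\dots,e_n$; the matrix coefficient $\pi_{ij}\in C^\infty(G)$ is $\pi_{ij}(g)=\langle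 e_i,\pi(g)e_j\rangle$ (inner product linear in the second variable), i.e. the $(i,j)$ entry of the matrix of $\pi(g)$.
   Formalization: The Haar measure μ is taken to be normalized, μ(G)=1; for total mass c the right side is c times the left side (e.g. u=v=1, π trivial gives c versus c²), so the identity fails for other normalizations. *)

(* Defs.v *)
(* Library: MathComp and MathComp-Analysis, over an abstract [R : realType];
   the complex numbers are [R[i]] (mathcomp-real-closed). *)
From HB Require Import structures.
From mathcomp Require Import all_boot all_order all_algebra.
From mathcomp Require Import all_classical all_reals all_analysis.
From mathcomp Require Import complex.

Set Implicit Arguments.
Unset Strict Implicit.
Unset Printing Implicit Defensive.

Import Order.TTheory GRing.Theory Num.Theory.
Import numFieldNormedType.Exports.

Local Open Scope classical_set_scope.
Local Open Scope ring_scope.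
Local Open Scope complex_scope.

(* [Ck k A f] is meant for open [A]: all iterated partial derivatives of [f]
   of order at most [k] exist and are continuous on [A]. *)
Fixpoint Ck (R : realType) (m : nat) (W : normedModType R) (k : nat)
    (A : set 'rV[R]_m) (f : 'rV[R]_m -> W) : Prop :=
  (forall x, A x -> {for x, continuous f}) /\
  if k is k'.+1 then
    forall i : 'I_m,
      (forall x, A x -> derivable f x (delta_mx 0 i)) /\
      Ck k' A (fun x => 'D_(delta_mx 0 i) f x)
  else True.

Definition smooth_on (R : realType) (m : nat) (W : normedModType R)
    (A : set 'rV[R]_m) (f : 'rV[R]_m -> W) : Prop :=
  forall k, Ck k A f.

Record chart (R : realType) (d : nat) (T : topologicalType) := Chart {
  chart_dom : set T;
  chart_map : T -> 'rV[R]_d;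
  chart_inv : 'rV[R]_d -> T;
  open_chart_dom : open chart_dom;
  open_chart_img : open (chart_map @` chart_dom);
  chart_mapK : forall x, chart_dom x -> chart_inv (chart_map x) = x;
  chart_map_continuous : {within chart_dom, continuous chart_map};
  chart_inv_continuous :
    {within chart_map @` chart_dom, continuous chart_inv} }.

Definition chart_img (R : realType) (d : nat) (T : topologicalType)
  (c : chart R d T) : set 'rV[R]_d := chart_map c @` chart_dom c.

HB.mixin Record isTopologicalGroup G of Group G & PointedTopological G := {
  mulg_continuous : continuous (fun z : G * G => (z.1 * z.2)%g);
  invg_continuous : continuous (fun x : G => (x^-1)%g) }.

#[short(type="topGroupType")]
HB.structure Definition TopologicalGroup :=
  {G of Group G & PointedTopological G & isTopologicalGroup G}.

HB.mixin Record isLieGroup (R : realType) (d : nat) G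
    of TopologicalGroup G := {
  lie_hausdorff : hausdorff_space G;
  lie_second_countable : @second_countable G;
  atlas : set (chart R d G);
  atlas_cover : forall x : G, exists2 c, atlas c & chart_dom c x;
  atlas_compatible : forall c1 c2, atlas c1 -> atlas c2 ->
    smooth_on (chart_map c1 @` (chart_dom c1 `&` chart_dom c2))
      (fun z => chart_map c2 (chart_inv c1 z));
  lie_mul_smooth : forall c1 c2 c3, atlas c1 -> atlas c2 -> atlas c3 ->
    smooth_on
      [set z : 'rV[R]_(d + d) |
         [/\ chart_img c1 (lsubmx z), chart_img c2 (rsubmx z) &
           chart_dom c3 (chart_inv c1 (lsubmx z) * chart_inv c2 (rsubmx z))%g]]
      (fun z =>
         chart_map c3 (chart_inv c1 (lsubmx z) * chart_inv c2 (rsubmx z))%g);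
  lie_inv_smooth : forall c1 c2, atlas c1 -> atlas c2 ->
    smooth_on
      [set z : 'rV[R]_d | chart_img c1 z /\ chart_dom c2 (chart_inv c1 z)^-1%g]
      (fun z => chart_map c2 (chart_inv c1 z)^-1%g) }.

#[short(type="lieGroupType")]
HB.structure Definition LieGroup (R : realType) (d : nat) :=
  {G of TopologicalGroup G & isLieGroup R d G}.

Section LieGroupDefs.
Variables (R : realType) (d : nat) (G : lieGroupType R d).

Definition smooth_fun (f : G -> R[i]) : Prop :=
  forall c : chart R d G, atlas c ->
    smooth_on (chart_img c) (fun z => complex.Re (f (chart_inv c z)) : R^o) /\
    smooth_on (chart_img c) (fun z => complex.Im (f (chart_inv c z)) : R^o).

Definition borelType := g_sigma_algebraType (@open G).

(* Regular left Haar measure, with no normalization.  The total mass matters for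
   identities that compare different numbers of convolutions: with u = v = 1
   and the trivial one-dimensional representation, the left and right sides of
   the interchange law are c and c ^ 2, where c is the total mass. *)
Definition haar_measure (mu : {measure set borelType -> \bar R}) : Prop :=
  [/\ forall (g : G) (A : set borelType), measurable A ->
        mu [set (g * x)%g | x in A] = mu A,
      forall C : set G, compact C -> (mu C < +oo)%E,
      forall A : set borelType, measurable A ->
        mu A = ereal_inf [set mu U | U in [set U : set G | open U /\ A `<=` U]],
      forall U : set G, open U ->
        mu U = ereal_sup [set mu C | C in [set C : set G | compact C /\ C `<=` U]]
    & mu [set: G] != 0%E].

Definition cintegral (mu : {measure set borelType -> \bar R})
    (f : G -> R[i]) : R[i] :=
  (\int[mu]_(h in [set: borelType]) complex.Re (f h))%R +i*
  (\int[mu]_(h in [set: borelType]) complex.Im (f h))%R.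

(* [rep_form] is linear in its FIRST argument, so the inner product <x, y> that
   is linear in the second argument is [rep_form y x].  Each [rep_map g] is
   invertible by [rep_map1] and [rep_mapM]; the topology on GL(V) is that of
   the matrices in the given basis. *)
Record representation (n : nat) := Representation {
  rep_space : vectType R[i];
  rep_form : {dot rep_space for Num.conj};
  rep_basis : n.-tuple rep_space;
  rep_basisP : basis_of fullv rep_basis;
  rep_basis_orthonormal : orthonormal rep_form rep_basis;
  rep_map : G -> 'End(rep_space);
  rep_map1 : rep_map 1%g = \1%VF;
  rep_mapM : forall g h : G, rep_map (g * h)%g = (rep_map g \o rep_map h)%VF;
  rep_unitary : forall g, isometry rep_form rep_form (rep_map g);
  rep_continuous :
    continuous (fun g => (\matrix_(i < n, j < n)
      rep_form (rep_map g (tnth rep_basis j)) (tnth rep_basis i))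
      : 'M[R[i]^o]_n) }.

Definition matrix_coef (n : nat) (pi : representation n) (i j : 'I_n) (g : G)
    : R[i] :=
  rep_form pi (rep_map pi g (tnth (rep_basis pi) j)) (tnth (rep_basis pi) i).

Section Convolutions.
Variables (P : pred G) (K : subGroupType P).

(* The sums over [K] are finite-support sums: for [f], [f'] in C_c^oo(K x G)
   only finitely many terms are nonzero, as [K] is discrete. *)
Definition action_conv (f f' : K * G -> R[i]) : K * G -> R[i] := fun p =>
  \sum_(l \in [set: K])
    f (l, ((val l)^-1 * val p.1 * p.2)%g) * f' ((l^-1 * p.1)%g, p.2).

Definition product_conv (mu : {measure set borelType -> \bar R})
    (f f' : K * G -> R[i]) : K * G -> R[i] := fun p =>
  \sum_(l \in [set: K])
    cintegral mu (fun h : G => f (l, h) * f' ((l^-1 * p.1)%g, (h^-1 * p.2)%g)).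

Definition extend_at (k : K) (u : G -> R[i]) : K * G -> R[i] := fun p =>
  if p.1 == k then u p.2 else 0.

End Convolutions.

End LieGroupDefs.

(* Main.v *)
Require Import Defs.
From HB Require Import structures.
From mathcomp Require Import all_boot all_order all_algebra.
From mathcomp Require Import all_classical all_reals all_analysis.
From mathcomp Require Import measurable_realfun complex.

Set Implicit Arguments.
Unset Strict Implicit.
Unset Printing Implicit Defensive.

Import Order.TTheory GRing.Theory Num.Theory.
Import numFieldNormedType.Exports.

Local Open Scope classical_set_scope.
Local Open Scope ring_scope.
Local Open Scope complex_scope.

(** Both convolutions of two functions supported on single slices of [K * G]
are supported on a single slice: writing [f^a] for [extend_at a f],
  - the action product of [u^a] and [f^b] is [(y |-> u (b y) f y)^(a b)]
    ([action_conv_extend]),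
  - the group product of [u^a] and [f^b] is
    [(y |-> \int u h * f (h^-1 y) dh)^(a b)] ([product_conv_extend]).

With [w h = u (l1 h) v (l2 h^-1 y)], the left-hand side therefore lives on the
slice [k1 l1 k2 l2], where it is the sum over [j] of the integrals of
[w h * pi_ij h * pi_jk (h^-1 y)].  Since [pi] is a homomorphism, the sum over
[j] of [pi_ij h * pi_jk (h^-1 y)] is [pi_ik y] ([matrix_coefM]), which does
not depend on [h], and the value is [pi_ik y * \int w].

The right-hand side lives on the slice [k1 k2 l1 l2], where it is
[\int u h * v (h^-1 l1 l2 y) dh] times the sum over [j] of
[\int pi_ij h * pi_jk (h^-1 y) dh].  By the same identity the second factor is
[pi_ik y], the total mass being one.  The substitution of [l1 h] for [h], by
left invariance of the measure ([cintegral_translate]), turns the first factor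
into [\int u (l1 h) * v (h^-1 l2 y) dh].

What is left is to exchange [l1] with [k2] and [l2] with [h^-1], and both
exchanges hold because [K] is central ([countable_normal_central]): the
conjugates of an element of [K] by the points of the connected group [G] form
a countable connected set, hence a single point.

Sums and integrals may be exchanged because everything in sight is continuous,
hence bounded and integrable: [G] is compact and its measure finite. *)

(** * Countable normal subgroups of connected groups *)

Lemma itv01_uncountable (R : realType) : ~ countable (`[0, 1]%classic : set R).
Proof.
move=> /countable_lebesgue_measure0.
rewrite lebesgue_measure_itv /= lte_fin ltr01 oppr0 adde0 => /eqP.
by rewrite eqe oner_eq0.
Qed.

(** A continuous real function separating two values of [f] would send the
connected space [T] onto a set containing [[0, 1]], while factoring through
the countable range of [f]. *)
Lemma countable_range_connected_constant (R : realType) (T U : topologicalType)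
    (f : T -> U) :
  connected [set: T] -> hausdorff_space U -> compact [set: U] ->
  continuous f -> countable (range f) -> forall x y, f x = f y.
Proof.
move=> connT hU compU cf countf x y; apply: contrapT => fxy.
have normU := compact_normal hU compU.
have cl1 z : closed [set z : U].
  by apply: accessible_closed_set1; exact: hausdorff_accessible.
have sep : uniform_separator [set f x] [set f y].
  apply: (normal_uniform_separator normU) => //.
  by apply/disjoints_subset => z ->.
have [phi [cphi _ phi0 phi1]] := (@uniform_separatorP U R _ _).1 sep.
have phix : phi (f x) = 0 by apply: phi0; exists (f x).
have phiy : phi (f y) = 1 by apply: phi1; exists (f y).
have : connected (range (phi \o f)).
  apply: connected_continuous_connected => //; apply: continuous_subspaceT.
  by move=> z; apply: continuous_comp; [exact: cf|exact: cphi].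
move=> /connected_intervalP itv_range.
apply: (@itv01_uncountable R).
apply: (@sub_countable _ _ _ (range f)) => //.
apply: (card_le_trans _ (card_image_le phi (range f))).
apply: subset_card_le => t /=; rewrite in_itv /= => t01.
have [||z _ <-] := itv_range 0 1 _ _ t t01.
- by exists x.
- by exists y.
by exists (f z) => //; exists z.
Qed.

Lemma continuous_mulg (T : topologicalType) (G : topGroupType) (p q : T -> G) :
  continuous p -> continuous q -> continuous (fun t => (p t * q t)%g).
Proof.
move=> cp cq t.
apply: (@continuous_comp _ _ _ (fun t => (p t, q t))
          (fun z : G * G => (z.1 * z.2)%g)).
  by apply: cvg_pair => //=; [exact: cp|exact: cq].
exact: mulg_continuous.
Qed.

Lemma continuous_mull (G : topGroupType) (a : G) :
  continuous (fun g : G => (a * g)%g).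
Proof. by apply: continuous_mulg => g; [exact: cvg_cst|exact: cvg_id]. Qed.

(** The conjugation orbit [g |-> g k g^-1] is continuous with values in the
countable set [N], so it is constant, equal to its value [k] at the unit. *)
Lemma countable_normal_central (R : realType) (G : topGroupType) (N : set G) :
  hausdorff_space G -> compact [set: G] -> connected [set: G] ->
  countable N -> (forall k g, N k -> N (g * k * g^-1)%g) ->
  forall k g, N k -> (g * k = k * g)%g.
Proof.
move=> hG cG connG cN nN k g Nk.
have ccj : continuous (fun h : G => (h * k * h^-1)%g).
  apply: continuous_mulg; last exact: invg_continuous.
  by apply: continuous_mulg => h; [exact: cvg_id|exact: cvg_cst].
have cntble : countable (range (fun h : G => (h * k * h^-1)%g)).
  apply: sub_countable cN; apply: subset_card_le => _ [h _ <-]; exact: nN.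
have := countable_range_connected_constant R connG hG cG ccj cntble g 1%g.
rewrite invg1 mulg1 mul1g => gkg.
by rewrite -{2}gkg mulgVK.
Qed.

(** * Multiplicativity of matrix coefficients *)

Lemma orthonormal_expansion (C : numClosedFieldType) (V : vectType C)
    (form : {dot V for Num.conj}) (n : nat) (e : n.-tuple V) (v : V) :
  basis_of fullv e -> orthonormal form e ->
  v = \sum_(j < n) form v (tnth e j) *: tnth e j.
Proof.
move=> basis_e /orthonormalP[uniq_e orth].
have vE := coord_basis basis_e (memvf v).
rewrite {1}vE; apply: eq_bigr => j _; rewrite [X in _ = form X _ *: _]vE.
rewrite linear_sumlz (bigD1 j) //= big1 ?addr0 => [|i ij].
  by rewrite linearZl_LR /= -tnth_nth orth ?mem_tnth// eqxx mulr1.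
rewrite linearZl_LR /= -tnth_nth orth ?mem_tnth//.
by rewrite (inj_eq (tuple_uniqP _ uniq_e)) (negPf ij) mulr0.
Qed.

(** The coordinates of [pi h e_k] in the orthonormal basis are the
[matrix_coef pi j k h], by linearity of the form in its first argument. *)
Lemma matrix_coefM (R : realType) (d : nat) (G : lieGroupType R d) (n : nat)
    (pi : representation G n) (g h : G) (i k : 'I_n) :
  matrix_coef pi i k (g * h)%g =
  \sum_(j < n) matrix_coef pi i j g * matrix_coef pi j k h.
Proof.
rewrite /matrix_coef rep_mapM comp_lfunE.
rewrite {1}(orthonormal_expansion (rep_map pi h _) (rep_basisP pi)
              (rep_basis_orthonormal pi)) linear_sum linear_sumlz.
by apply: eq_bigr => j _; rewrite linearZ linearZl_LR /= mulrC.
Qed.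

(** * Continuous complex-valued functions *)

Section ComplexContinuity.
Variable R : realType.

Lemma normc_ge_Im (x : R[i]) : `|complex.Im x|%:C <= `|x|.
Proof.
by case: x => a b; simpc; rewrite -sqrtr_sqr ler_wsqrtr // lerDr sqr_ge0.
Qed.

(** Continuity is expressed on real and imaginary parts because both
[smooth_fun] and [cintegral] are defined through these parts. *)
Definition ccontinuous (T : topologicalType) (f : T -> R[i]) :=
  continuous (fun t => complex.Re (f t)) /\
  continuous (fun t => complex.Im (f t)).

Lemma ccontinuousM (T : topologicalType) (f g : T -> R[i]) :
  ccontinuous f -> ccontinuous g -> ccontinuous (fun t => f t * g t).
Proof.
move=> [rf jf] [rg jg]; split.
  have -> : (fun t => complex.Re (f t * g t)) = (fun t =>
      complex.Re (f t) * complex.Re (g t)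
      - complex.Im (f t) * complex.Im (g t)).
    by apply/funext => t /=; case: (f t); case: (g t).
  move=> t; apply: cvgB; apply: cvgM; [exact: rf|exact: rg|exact: jf|exact: jg].
have -> : (fun t => complex.Im (f t * g t)) = (fun t =>
    complex.Re (f t) * complex.Im (g t) + complex.Im (f t) * complex.Re (g t)).
  by apply/funext => t /=; case: (f t); case: (g t).
move=> t; apply: cvgD; apply: cvgM;
  [exact: rf|exact: jg|exact: jf|exact: rg].
Qed.

Lemma ccontinuousD (T : topologicalType) (f g : T -> R[i]) :
  ccontinuous f -> ccontinuous g -> ccontinuous (fun t => f t + g t).
Proof.
move=> [rf jf] [rg jg]; split.
  have -> : (fun t => complex.Re (f t + g t)) =
      (fun t => complex.Re (f t) + complex.Re (g t)).
    by apply/funext => t /=; case: (f t); case: (g t).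
  by move=> t; apply: cvgD; [exact: rf|exact: rg].
have -> : (fun t => complex.Im (f t + g t)) =
    (fun t => complex.Im (f t) + complex.Im (g t)).
  by apply/funext => t /=; case: (f t); case: (g t).
by move=> t; apply: cvgD; [exact: jf|exact: jg].
Qed.

Lemma ccontinuous_sum (T : topologicalType) (I : Type) (r : seq I)
    (f : I -> T -> R[i]) :
  (forall i, ccontinuous (f i)) -> ccontinuous (fun t => \sum_(i <- r) f i t).
Proof.
move=> cf; elim: r => [|i r IHr].
  by under eq_fun do rewrite big_nil; split=> t; exact: cvg_cst.
by under eq_fun do rewrite big_cons; exact: ccontinuousD.
Qed.

Lemma ccontinuous_comp (T U : topologicalType) (p : T -> U) (f : U -> R[i]) :
  continuous p -> ccontinuous f -> ccontinuous (fun t => f (p t)).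
Proof.
move=> cp [rf jf]; split=> t.
  exact: (continuous_comp (cp t) (rf _)).
exact: (continuous_comp (cp t) (jf _)).
Qed.

(** The real and imaginary parts are 1-Lipschitz for the modulus, which defines
the topology of [R[i]^o]. *)
Lemma continuous_ccontinuous (T : topologicalType) (f : T -> R[i]^o) :
  continuous f -> ccontinuous f.
Proof.
move=> cf; split=> t; apply/cvgrPdist_lt => e e0.
  have /cvgrPdist_lt/(_ e%:C) := cf t; rewrite ltcR => /(_ e0).
  apply: filterS => s; rewrite -ltcR; apply: le_lt_trans.
  rewrite (_ : _ - _ = complex.Re (f t - f s)); first exact: normc_ge_Re.
  by case: (f t); case: (f s).
have /cvgrPdist_lt/(_ e%:C) := cf t; rewrite ltcR => /(_ e0).
apply: filterS => s; rewrite -ltcR; apply: le_lt_trans.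
rewrite (_ : _ - _ = complex.Im (f t - f s)); first exact: normc_ge_Im.
by case: (f t); case: (f s).
Qed.

End ComplexContinuity.

Section Smooth.
Variables (R : realType) (d : nat) (G : lieGroupType R d).

(** Chart domains are open, so continuity at a point may be read off in a
chart. *)
Lemma chart_continuous_at (c : chart R d G) (f : 'rV[R]_d -> R) (g : G -> R)
    (x : G) :
  chart_dom c x -> {for chart_map c x, continuous f} ->
  (forall y, chart_dom c y -> g y = f (chart_map c y)) ->
  {for x, continuous g}.
Proof.
move=> cx cf gf.
have nx : nbhs x (chart_dom c).
  by apply: open_nbhs_nbhs; split=> //; exact: open_chart_dom.
have cmap : {for x, continuous (chart_map c)}.
  have := @chart_map_continuous _ _ _ c.
  rewrite continuous_open_subspace; last exact: open_chart_dom.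
  by apply; rewrite inE.
have cfm := continuous_comp cmap cf.
rewrite /prop_for /continuous_at gf//.
apply: cvg_trans cfm; apply: near_eq_cvg.
by apply: filterS nx => y cy; rewrite /= gf.
Qed.

Lemma smooth_ccontinuous (u : G -> R[i]) : smooth_fun u -> ccontinuous u.
Proof.
move=> su; split=> x; have [c ac cx] := atlas_cover x; have [sr si] := su c ac.
  apply: (chart_continuous_at cx ((sr 0%N).1 _ _)) => [|y cy].
    by exists x.
  by rewrite chart_mapK.
apply: (chart_continuous_at cx ((si 0%N).1 _ _)) => [|y cy]; first by exists x.
by rewrite chart_mapK.
Qed.

Lemma matrix_coef_ccontinuous n (pi : representation G n) i j :
  ccontinuous (matrix_coef pi i j).
Proof.
pose M g : 'M[R[i]^o]_n := \matrix_(i < n, j < n)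
  rep_form pi (rep_map pi g (tnth (rep_basis pi) j)) (tnth (rep_basis pi) i).
have -> : matrix_coef pi i j = (fun g => M g i j).
  by apply/funext => g; rewrite mxE.
apply: continuous_ccontinuous => g.
apply: (@continuous_comp _ _ _ M (fun N : 'M[R[i]^o]_n => N i j)).
  exact: (@rep_continuous _ _ _ _ pi g).
exact: coord_continuous.
Qed.
End Smooth.

(** * Integration over a compact group *)

Section Integration.
Variables (R : realType) (d : nat) (G : lieGroupType R d).

Lemma open_borel (U : set (borelType G)) : open (U : set G) -> measurable U.
Proof. by move=> oU; exact: sub_sigma_algebra. Qed.

Lemma continuous_borel_measurable (f : G -> R) :
  continuous f -> measurable_fun setT (f : borelType G -> R).
Proof.
move=> /continuousP cf; apply: (measurability _ (RGenOpens.measurableE R)).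
move=> _ [_ [a [b ->] <-]]; rewrite setTI; apply: open_borel.
exact/cf/interval_open.
Qed.

Lemma continuous_borel_endo_measurable (p : G -> G) :
  continuous p -> measurable_fun setT (p : borelType G -> borelType G).
Proof.
move=> /continuousP cp.
apply: (@measurability _ _ (borelType G) (borelType G) setT p (@open G) erefl).
move=> _ [U oU <-]; by rewrite setTI; apply: open_borel; exact: cp.
Qed.

Variable mu : {measure set (borelType G) -> \bar R}.

Lemma cintegral_cst (z : R[i]) :
  mu [set: G] = 1%E -> cintegral mu (fun=> z) = z.
Proof.
by move=> mu1; rewrite /cintegral !Rintegral_cst// mu1 !mulr1; case: z.
Qed.

Lemma cintegral0 : cintegral mu (fun=> 0) = 0.
Proof. by rewrite /cintegral /= Rintegral_cst// mul0r. Qed.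

Hypothesis compactG : compact [set: G].
Hypothesis mu_fin : (mu setT < +oo)%E.

Lemma continuous_integrable (f : G -> R) : continuous f ->
  mu.-integrable setT (EFin \o f).
Proof.
move=> cf; apply: measurable_bounded_integrable => //.
  exact: continuous_borel_measurable.
have : compact (range f).
  by apply: continuous_compact => //; exact: continuous_subspaceT.
move=> /compact_bounded [M [Mr MB]]; exists M; split => // x Mx y _ /=.
by apply: MB => //; exists y.
Qed.

(** Left invariance says that the measure is its own pushforward along
[h |-> a h], so this is the change of variables formula. *)
Lemma Rintegral_translate (a : G) (f : G -> R) :
  haar_measure mu -> continuous f ->
  \int[mu]_(h in [set: borelType G]) f (a * h)%g =
  \int[mu]_(h in [set: borelType G]) f h.
Proof.
move=> [inv _ _ _ _] cf.
pose p : borelType G -> borelType G := fun h => (a * h)%g.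
have cp : continuous (p : G -> G) by exact: continuous_mull.
have mp : measurable_fun setT p by exact: continuous_borel_endo_measurable.
have cfp : continuous (fun h : G => f (a * h)%g).
  by move=> h; apply: continuous_comp; [exact: cp|exact: cf].
rewrite /Rintegral; congr fine.
have := @integral_pushforward _ _ _ _ _ p mp mu setT (EFin \o f) _ _
  measurableT.
rewrite preimage_setT => <-.
- apply: eq_measure_integral => A mA _.
  have mpA : measurable (p @^-1` A) by rewrite -(setTI (p @^-1` A)); exact: mp.
  transitivity (mu (p @^-1` A)); first by [].
  rewrite -(inv a _ mpA); congr (mu _).
  apply/seteqP; split=> [_ [x px <-] //|x Ax].
  by exists (a^-1 * x)%g; rewrite /p/= mulVKg.
- by apply/measurable_EFinP; exact: continuous_borel_measurable.
- exact: (continuous_integrable cfp).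
Qed.

Lemma cintegralZl (z : R[i]) (f : G -> R[i]) : ccontinuous f ->
  cintegral mu (fun h => z * f h) = z * cintegral mu f.
Proof.
move=> [cr ci].
have mT := @measurableT _ (borelType G).
case: z => a b; rewrite /cintegral.
have -> : \int[mu]_(h in [set: borelType G]) complex.Re ((a +i* b) * f h) =
    \int[mu]_(h in [set: borelType G])
      (a * complex.Re (f h) - b * complex.Im (f h)).
  by apply: eq_Rintegral => h _; case: (f h).
have -> : \int[mu]_(h in [set: borelType G]) complex.Im ((a +i* b) * f h) =
    \int[mu]_(h in [set: borelType G])
      (a * complex.Im (f h) + b * complex.Re (f h)).
  by apply: eq_Rintegral => h _; case: (f h).
have scaled k (F : G -> R) : continuous F ->
    mu.-integrable setT (EFin \o (fun h => k * F h)).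
  move=> cF; apply: continuous_integrable => h.
  by apply: cvgM; [exact: cvg_cst|exact: cF].
have ir := continuous_integrable cr; have ii := continuous_integrable ci.
by rewrite RintegralB ?RintegralD ?RintegralZl//; exact: scaled.
Qed.

Lemma cintegral_translate (a : G) (f : G -> R[i]) : haar_measure mu ->
  ccontinuous f -> cintegral mu (fun h => f (a * h)%g) = cintegral mu f.
Proof.
move=> haar [cr ci]; rewrite /cintegral.
by rewrite (Rintegral_translate a haar cr) (Rintegral_translate a haar ci).
Qed.

Lemma cintegralD (f g : G -> R[i]) : ccontinuous f -> ccontinuous g ->
  cintegral mu (fun h => f h + g h) = cintegral mu f + cintegral mu g.
Proof.
move=> [/continuous_integrable rf /continuous_integrable jf].
move=> [/continuous_integrable rg /continuous_integrable jg].
have mT := @measurableT _ (borelType G).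
rewrite /cintegral; apply/eqP; rewrite eq_complex /= -!RintegralD//.
apply/andP; split; apply/eqP; apply: eq_Rintegral => h _;
  by case: (f h); case: (g h).
Qed.

Lemma cintegral_sum (I : Type) (r : seq I) (f : I -> G -> R[i]) :
  (forall i, ccontinuous (f i)) ->
  cintegral mu (fun h => \sum_(i <- r) f i h) =
  \sum_(i <- r) cintegral mu (f i).
Proof.
move=> cf; elim: r => [|i r IHr].
  by rewrite big_nil; under eq_fun do rewrite big_nil; exact: cintegral0.
rewrite big_cons -IHr; under eq_fun do rewrite big_cons.
by apply: cintegralD => //; exact: ccontinuous_sum.
Qed.

End Integration.

(** * Convolution of functions supported on single slices *)

Lemma fsbig_at (M : nmodType) (I : choiceType) (a : I) (F : I -> M) :
  (forall l, l != a -> F l = 0) -> \sum_(l \in [set: I]) F l = F a.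
Proof.
move=> F0; rewrite -(fsbig_widen [set a]) ?fsbig_set1//.
by move=> l [_ /= /eqP/F0].
Qed.

Section Slices.
Variables (R : realType) (d : nat) (G : lieGroupType R d).
Variables (P : pred G) (K : subGroupType P).

(** Only [l = a] contributes, and then [x = a b] turns the argument
[a^-1 x y] of [u] into [b y]. *)
Lemma action_conv_extend (a b : K) (u f : G -> R[i]) :
  action_conv (extend_at a u) (extend_at b f) =
  extend_at (a * b)%g (fun y => u (val b * y)%g * f y).
Proof.
apply/funext => -[x y]; rewrite /action_conv (@fsbig_at _ _ a) => [|l la].
  rewrite /extend_at /= eqxx -(inj_eq (mulgI a)) mulVKg.
  by case: eqP => [->|_]; rewrite ?mulr0// valM mulKg.
by rewrite /extend_at /= (negPf la) mul0r.
Qed.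

Lemma product_conv_extend (mu : {measure set (borelType G) -> \bar R})
    (a b : K) (u f : G -> R[i]) :
  product_conv mu (extend_at a u) (extend_at b f) =
  extend_at (a * b)%g (fun y => cintegral mu (fun h => u h * f (h^-1 * y)%g)).
Proof.
apply/funext => -[x y]; rewrite /product_conv (@fsbig_at _ _ a) => [|l la].
  rewrite /extend_at /= eqxx -(inj_eq (mulgI a)) mulVKg.
  case: eqP => // _; under eq_fun do rewrite mulr0; exact: cintegral0.
rewrite /extend_at /= (negPf la); under eq_fun do rewrite mul0r.
exact: cintegral0.
Qed.

Lemma sum_extend_at (I : Type) (r : seq I) (a : K) (f : I -> G -> R[i]) :
  \sum_(j <- r) extend_at a (f j) = extend_at a (fun y => \sum_(j <- r) f j y).
Proof.
rewrite fct_sumE; apply/funext => -[x y]; rewrite /extend_at /=.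
by case: eqP => // _; rewrite big1.
Qed.
End Slices.

(** * The interchange law *)

Theorem theorem1p2 (R : realType) (d : nat) (G : lieGroupType R d)
  (compactG : compact [set: G]) (connectedG : connected [set: G])
  (mu : {measure set (borelType G) -> \bar R})
  (haar_mu : haar_measure mu) (mu_normalized : mu [set: G] = 1%E)
  (P : pred G) (K : subGroupType P)
  (countableK : countable [set: K])
  (normalK : forall k g : G, k \in P -> (g * k * g^-1)%g \in P)
  (n : nat) (pi : representation G n)
  (u v : G -> R[i]) (smooth_u : smooth_fun u) (smooth_v : smooth_fun v)
  (k1 k2 l1 l2 : K) (i k : 'I_n) :
  \sum_(j < n)
     product_conv mu
       (action_conv (extend_at k1 u) (extend_at l1 (matrix_coef pi i j)))
       (action_conv (extend_at k2 v) (extend_at l2 (matrix_coef pi j k))) =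
  \sum_(j < n)
     action_conv
       (product_conv mu (extend_at k1 u) (extend_at k2 v))
       (product_conv mu (extend_at l1 (matrix_coef pi i j))
                        (extend_at l2 (matrix_coef pi j k))).
Proof.
have hG : hausdorff_space G := @lie_hausdorff R d G.
have mu_fin : (mu [set: borelType G] < +oo)%E by rewrite mu_normalized ltry.
have K_central (l : K) (g : G) : (g * val l = val l * g)%g.
  apply: (@countable_normal_central R G (range (val : K -> G))) => //.
  - by apply: sub_countable countableK; exact: card_image_le.
  - move=> _ h [m _ <-].
    have hm := normalK _ h (valP m).
    by exists (Sub (h * val m * h^-1)%g (hm : P _) : K) => //; rewrite SubK.
have comK (l m : K) : (l * m = m * l)%g.
  by apply: val_inj; rewrite !valM K_central.
have cu := smooth_ccontinuous smooth_u.
have cv := smooth_ccontinuous smooth_v.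
have cpi := matrix_coef_ccontinuous pi.
have cleft (a : G) : continuous (fun h : G => (a * h)%g).
  exact: continuous_mull.
have cinv (y : G) : continuous (fun h : G => (h^-1 * y)%g).
  apply: continuous_mulg; first exact: invg_continuous.
  by move=> h; exact: cvg_cst.
under eq_bigr do rewrite !action_conv_extend product_conv_extend.
under [RHS]eq_bigr do rewrite !product_conv_extend action_conv_extend.
rewrite !sum_extend_at.
have -> : (k1 * l1 * (k2 * l2) = k1 * k2 * (l1 * l2))%g.
  by rewrite !mulgA -(mulgA k1 l1) (comK l1) !mulgA.
congr extend_at; apply/funext => y.
pose w (h : G) := u (val l1 * h)%g * v (val l2 * (h^-1 * y))%g.
have cw : ccontinuous w.
  apply: ccontinuousM; apply: ccontinuous_comp => //.
  by apply: (continuous_mulg _ (cinv y)) => h; exact: cvg_cst.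
transitivity (matrix_coef pi i k y * cintegral mu w).
  rewrite -cintegral_sum// => [|j].
    rewrite -cintegralZl//; congr cintegral; apply/funext => h.
    (* [y] is split as [h (h^-1 y)] so that the coefficient of [pi] at [y]
       becomes the sum of products under the integral. *)
    have -> : matrix_coef pi i k y = matrix_coef pi i k (h * (h^-1 * y))%g.
      by rewrite mulVKg.
    rewrite matrix_coefM mulr_suml; apply: eq_bigr => j _.
    by rewrite /w mulrACA [RHS]mulrC.
  apply: ccontinuousM; apply: ccontinuousM => //.
  - exact: ccontinuous_comp.
  - apply: ccontinuous_comp (cv).
    by apply: continuous_mulg (cinv y) => h; exact: cvg_cst.
  - exact: ccontinuous_comp.
rewrite -mulr_sumr mulrC; congr (_ * _).
  (* Substituting [l1 h] for [h] cancels [l1] inside [v]. *)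
  rewrite -[RHS](cintegral_translate compactG mu_fin (val l1))//.
    congr cintegral; apply/funext => h; rewrite /w; congr (_ * v _).
    rewrite valM invgM -!mulgA mulKg.
    by rewrite !mulgA K_central.
  by apply: ccontinuousM => //; apply: ccontinuous_comp.
rewrite -cintegral_sum// => [|j].
  under eq_fun => h do rewrite -matrix_coefM mulVKg.
  by rewrite cintegral_cst.
by apply: ccontinuousM => //; apply: ccontinuous_comp.
Qed.
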